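(* Let $\tau$ be a relational vocabulary whose symbols are at most binary. For every formula $\phi\in\mathsf{D}^2[\tau]$ there is a sentence $\phi^*\in\mathsf{ESO}[\tau\cup\{R\}]$, where $R\notin\tau$ is a relation symbol of arity $|\mathrm{Fr}(\phi)|$, of the form $$\phi^*=\exists R_1\ldots\exists R_k\,\psi,$$ where each $R_i$ is a relation variable of arity at most $2$ and $\psi\in\mathsf{FOC}^2$, such that for all $\tau$-structures $\mathfrak{A}$ and all teams $X$ of $\mathfrak{A}$ with $\mathrm{dom}(X)=\mathrm{Fr}(\phi)$, $$\mathfrak{A}\models_X\phi\iff(\mathfrak{A},\mathrm{rel}(X))\models\phi^*,$$ where $(\mathfrak{A},\mathrm{rel}(X))$ is the expansion $\mathfrak{A}'$ of $\mathfrak{A}$ to the vocabulary $\tau\cup\{R\}$ with $R^{\mathfrak{A}'}:=\mathrm{rel}(X)$.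
   Context: $\mathsf{ESO}$ is existential second-order logic. $\mathsf{FOC}^2$ is first-order logic with equality restricted to two variables $x,y$ and extended by the counting quantifiers $\exists^{\ge i}$ (''there exist at least $i$ elements''), $i\in\mathbb{N}$. Syntax of $\mathsf{D}^2[\tau]$ (two-variable dependence logic), with variables $x,y$: $\phi::= t_1=t_2\mid P(t_1,\dots,t_n)\mid \neg t_1=t_2\mid \neg P(t_1,\dots,t_n)\mid =\!(t_1,t_2)\mid \neg =\!(t_1,t_2)\mid =\!(t_1)\mid\neg =\!(t_1)\mid(\phi\wedge\phi)\mid(\phi\vee\phi)\mid\forall x\phi\mid\forall y\phi\mid\exists x\phi\mid\exists y\phi$, where $P\in\tau$ is $n$-ary and $t_1,\dots,t_n\in\{x,y\}$. $\mathrm{Fr}(\phi)$ is the set of free variables, defined as in first-order logic, where all variables occurring in a dependence atom are free in it. Teams. A team $X$ of $\mathfrak{A}$ (domain $A$) with domain $\mathrm{dom}(X)=\{x_1,\dots,x_k\}$ (possibly empty) is any set of assignments $\{x_1,\dots,x_k\}\to A$; $\mathrm{rel}(X)=\{(s(x_1),\dots,s(x_k))\mid s\in X\}$ (variables listed in a fixed order, $x$ before $y$). When $\mathrm{dom}(X)=\emptyset$, $\mathrm{rel}(X)$ is $\emptyset$ or $\{\emptyset\}$. 0-ary relation symbols are allowed; their possible interpretations are $\emptyset$ and $\{\emptyset\}$, and $\mathfrak{A}\models R$ iff $R^{\mathfrak{A}}=\{\emptyset\}$. The assignment $s(a/x)$ has domain $\mathrm{dom}(s)\cup\{x\}$, maps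 $x$ to $a$ and agrees with $s$ elsewhere. For $F\colon X\to A$, $X(F/x)=\{s(F(s)/x)\mid s\in X\}$, and $X(A/x)=\{s(a/x)\mid s\in X,a\in A\}$. Semantics (with $\mathrm{Fr}(\phi)\subseteq\mathrm{dom}(X)$). (1) For a first-order literal $\phi$: $\mathfrak{A}\models_X\phi$ iff every $s\in X$ satisfies $\phi$ in $\mathfrak{A}$ in the usual sense. (2) $\mathfrak{A}\models_X\psi\wedge\phi$ iff $\mathfrak{A}\models_X\psi$ and $\mathfrak{A}\models_X\phi$. (3) $\mathfrak{A}\models_X\psi\vee\phi$ iff $X=Y\cup Z$ for some teams $Y,Z$ with $\mathfrak{A}\models_Y\psi$ and $\mathfrak{A}\models_Z\phi$. (4) $\mathfrak{A}\models_X\exists v\psi$ iff $\mathfrak{A}\models_{X(F/v)}\psi$ for some $F\colon X\to A$. (5) $\mathfrak{A}\models_X\forall v\psi$ iff $\mathfrak{A}\models_{X(A/v)}\psi$. (6) $\mathfrak{A}\models_X{=}(t_1,\dots,t_n)$ iff any $s,s'\in X$ that give equal values to each of $t_1,\dots,t_{n-1}$ give equal values to $t_n$. (7) $\mathfrak{A}\models_X\neg{=}(t_1,\dots,t_n)$ iff $X=\emptyset$. *)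

(* Defs.v *)
From HB Require Import structures.
From mathcomp Require Import all_boot.

Set Implicit Arguments.
Unset Strict Implicit.
Unset Printing Implicit Defensive.

Inductive var := vx | vy.

Definition bool_of_var (v : var) : bool := if v is vx then true else false.
Definition var_of_bool (b : bool) : var := if b then vx else vy.

Lemma bool_of_varK : cancel bool_of_var var_of_bool.
Proof. by case. Qed.

HB.instance Definition _ := Countable.copy var (can_type bool_of_varK).

Lemma var_enumP : Finite.axiom [:: vx; vy].
Proof. by case. Qed.

(* The explicit list fixes the order used by [enum]: x comes before y. *)
HB.instance Definition _ := isFinite.Build var var_enumP.

Record vocab := Vocab { sym : Type; ar : sym -> nat }.
Arguments ar {_} _.

(* As usual in logic, domains are nonempty. *)
Record structure (sigma : vocab) := Structure {
  carrier :> Type;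
  carrier_inh : inhabited carrier;
  interp : forall P : sym sigma, (ar P).-tuple carrier -> Prop
}.

(* sigma together with new symbols, disjoint from those of sigma, indexed by I;
   the symbol i has arity r i. *)
Definition extend (sigma : vocab) (I : Type) (r : I -> nat) : vocab :=
  @Vocab (sym sigma + I) (fun P => match P with inl Q => ar Q | inr i => r i end).

Definition expand (sigma : vocab) (I : Type) (r : I -> nat)
    (A : structure sigma) (S : forall i : I, (r i).-tuple A -> Prop) :
    structure (extend sigma r) :=
  @Structure (extend sigma r) A (carrier_inh A)
    (fun P => match P return (ar (P : sym (extend sigma r))).-tuple A -> Prop with
              | inl Q => @interp sigma A Q
              | inr i => S i
              end).

Definition extend1 (sigma : vocab) (n : nat) : vocab :=
  extend sigma (fun _ : unit => n).

Definition expand1 (sigma : vocab) (n : nat) (A : structure sigma)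
    (S : n.-tuple A -> Prop) : structure (extend1 sigma n) :=
  expand (r := fun _ : unit => n) (fun _ => S).

(* Assignments are partial maps; [None] marks the variables outside the
   domain. *)
Definition assignment (A : Type) := {ffun var -> option A}.

Definition dom (A : Type) (s : assignment A) : {set var} := [set v | isSome (s v)].

Definition empty_assignment (A : Type) : assignment A := [ffun=> None].

Definition update (A : Type) (s : assignment A) (v : var) (a : A) : assignment A :=
  [ffun u => if u == v then Some a else s u].

Inductive atom (sigma : vocab) :=
| AEq (t1 t2 : var)
| ARel (P : sym sigma) (ts : (ar P).-tuple var).
Arguments AEq {sigma} _ _.

Definition atom_Fr (sigma : vocab) (a : atom sigma) : {set var} :=
  match a with
  | AEq t1 t2 => [set t1; t2]
  | ARel P ts => [set v in ts]
  end.

(* Only meaningful when atom_Fr a \subset dom s. *)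
Definition atom_sat (sigma : vocab) (A : structure sigma) (s : assignment A)
    (a : atom sigma) : Prop :=
  match a with
  | AEq t1 t2 => s t1 = s t2
  | ARel P ts =>
      exists2 b : (ar P).-tuple A, [seq s t | t <- ts] = [seq Some c | c <- b]
                                 & interp b
  end.

Inductive d2 (sigma : vocab) :=
| DLit (a : atom sigma)
| DNegLit (a : atom sigma)
| DDep2 (t1 t2 : var)
| DNegDep2 (t1 t2 : var)
| DDep1 (t : var)
| DNegDep1 (t : var)
| DAnd (phi psi : d2 sigma)
| DOr (phi psi : d2 sigma)
| DForall (v : var) (phi : d2 sigma)
| DExists (v : var) (phi : d2 sigma).
Arguments DDep2 {sigma} _ _.
Arguments DNegDep2 {sigma} _ _.
Arguments DDep1 {sigma} _.
Arguments DNegDep1 {sigma} _.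

Fixpoint d2_Fr (sigma : vocab) (phi : d2 sigma) : {set var} :=
  match phi with
  | DLit a | DNegLit a => atom_Fr a
  | DDep2 t1 t2 | DNegDep2 t1 t2 => [set t1; t2]
  | DDep1 t | DNegDep1 t => [set t]
  | DAnd phi psi | DOr phi psi => d2_Fr phi :|: d2_Fr psi
  | DForall v phi | DExists v phi => d2_Fr phi :\ v
  end.

Definition team (A : Type) := assignment A -> Prop.

(* The empty team has every domain. *)
Definition has_dom (A : Type) (X : team A) (D : {set var}) : Prop :=
  forall s, X s -> dom s = D.

(* rel X for a team X with domain D; [enum D] lists x before y. *)
Definition rel_of_team (A : Type) (D : {set var}) (X : team A) :
    #|D|.-tuple A -> Prop :=
  fun b => exists2 s, X s & [seq s v | v <- enum D] = [seq Some c | c <- b].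

(* F is taken on all assignments: its values outside X are not used. *)
Definition team_supplement (A : Type) (X : team A) (v : var)
    (F : assignment A -> A) : team A :=
  fun s' => exists2 s, X s & s' = update s v (F s).

Definition team_duplicate (A : Type) (X : team A) (v : var) : team A :=
  fun s' => exists2 s, X s & exists a : A, s' = update s v a.

(* The dependence atom =(ts, t). *)
Definition dep (A : Type) (X : team A) (ts : seq var) (t : var) : Prop :=
  forall s s', X s -> X s' -> {in ts, forall u, s u = s' u} -> s t = s' t.

(* Only meaningful when X has a domain containing d2_Fr phi. *)
Fixpoint d2_sat (sigma : vocab) (A : structure sigma) (X : team A)
    (phi : d2 sigma) : Prop :=
  match phi with
  | DLit a => forall s, X s -> atom_sat s a
  | DNegLit a => forall s, X s -> ~ atom_sat s a
  | DDep2 t1 t2 => dep X [:: t1] t2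
  | DDep1 t => dep X [::] t
  | DNegDep2 _ _ | DNegDep1 _ => forall s, ~ X s
  | DAnd phi psi => d2_sat X phi /\ d2_sat X psi
  | DOr phi psi =>
      exists Y Z : team A,
        [/\ forall s, X s <-> Y s \/ Z s, d2_sat Y phi & d2_sat Z psi]
  | DExists v phi =>
      exists F : assignment A -> A, d2_sat (team_supplement X v F) phi
  | DForall v phi => d2_sat (team_duplicate X v) phi
  end.

Inductive foc2 (sigma : vocab) :=
| FAtom (a : atom sigma)
| FNot (phi : foc2 sigma)
| FAnd (phi psi : foc2 sigma)
| FOr (phi psi : foc2 sigma)
| FForall (v : var) (phi : foc2 sigma)
| FExists (v : var) (phi : foc2 sigma)
| FAtLeast (i : nat) (v : var) (phi : foc2 sigma).

Fixpoint foc2_Fr (sigma : vocab) (phi : foc2 sigma) : {set var} :=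
  match phi with
  | FAtom a => atom_Fr a
  | FNot phi => foc2_Fr phi
  | FAnd phi psi | FOr phi psi => foc2_Fr phi :|: foc2_Fr psi
  | FForall v phi | FExists v phi | FAtLeast _ v phi => foc2_Fr phi :\ v
  end.

Fixpoint foc2_sat (sigma : vocab) (A : structure sigma) (s : assignment A)
    (phi : foc2 sigma) : Prop :=
  match phi with
  | FAtom a => atom_sat s a
  | FNot phi => ~ foc2_sat s phi
  | FAnd phi psi => foc2_sat s phi /\ foc2_sat s psi
  | FOr phi psi => foc2_sat s phi \/ foc2_sat s psi
  | FForall v phi => forall a : A, foc2_sat (update s v a) phi
  | FExists v phi => exists a : A, foc2_sat (update s v a) phi
  | FAtLeast i v phi =>
      exists2 f : 'I_i -> A, injective f & forall j, foc2_sat (update s v (f j)) phi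
  end.

(* A formula exists R_1 ... exists R_k, psi of ESO[sigma] with psi in FOC^2.
   Counting quantifiers are first-order definable (with more variables), so
   this is a fragment of ESO. *)
Record eso_foc2 (sigma : vocab) := EsoFoc2 {
  eso_size : nat;
  eso_ar : 'I_eso_size -> nat;
  eso_matrix : foc2 (extend sigma eso_ar)
}.

Definition eso_sentence (sigma : vocab) (Phi : eso_foc2 sigma) : Prop :=
  foc2_Fr (eso_matrix Phi) = set0.

Definition eso_holds (sigma : vocab) (A : structure sigma)
    (Phi : eso_foc2 sigma) : Prop :=
  exists S : forall i, (eso_ar (e := Phi) i).-tuple A -> Prop,
    foc2_sat (A := expand S) (empty_assignment A) (eso_matrix Phi).

(* Main.v *)
(* Every team arising in the evaluation of phi gets a relation symbol: the root
   team is R, and each disjunct and each quantified subformula gets a quantified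
   symbol.  Dependence logic is downward closed, so it suffices that these
   symbols denote upper bounds of the teams: a disjunct pair must cover the
   current team, and an existential quantifier asks for one witness per
   assignment.  Both are implications over one prefix forall x forall y, as are
   the literals; dependence atoms say "not at least two values".  Conversely the
   exact teams of an evaluation satisfy all these clauses.  Carrying the domain
   of the current team along, instead of cutting it down to the free variables
   of each subformula, avoids any appeal to locality. *)

Require Import Defs.
From mathcomp Require Import all_boot.
From Stdlib Require Import Classical ClassicalEpsilon.

Set Implicit Arguments.
Unset Strict Implicit.
Unset Printing Implicit Defensive.

(** * Passing between partial and total assignments *)

Definition restrict (A : Type) (D : {set var}) (s : assignment A) :
    assignment A :=
  [ffun v => if v \in D then s v else None].

(** Members of a team are partial, while clauses are read at total assignments; [fill] leads from
    the former to the latter, and [restrict] back. *)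
Definition fill (A : Type) (a : A) (s : assignment A) : assignment A :=
  [ffun v => Some (odflt a (s v))].

Lemma eq_assignment (A : Type) (s s' : assignment A) :
  dom s = dom s' -> {in dom s, s =1 s'} -> s = s'.
Proof.
move=> eqd eqs; apply/ffunP => v; case: (boolP (v \in dom s)) => [/eqs //|].
move=> vs; move: (vs); rewrite eqd; move: vs; rewrite !inE.
by case: (s v) => // _; case: (s' v).
Qed.

Lemma domP (A : Type) (s : assignment A) v :
  v \in dom s -> exists a, s v = Some a.
Proof. by rewrite inE; case: (s v) => // a _; exists a. Qed.

Lemma dom_restrict (A : Type) (D : {set var}) (s : assignment A) :
  dom s = setT -> dom (restrict D s) = D.
Proof.
move=> /setP sT; apply/setP => v; move: (sT v); rewrite !inE ffunE.
by case: (v \in D).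
Qed.

Lemma restrict_eq (A : Type) (D : {set var}) (s : assignment A) :
  {in D, restrict D s =1 s}.
Proof. by move=> v vD; rewrite ffunE vD. Qed.

Lemma dom_update (A : Type) (s : assignment A) v a :
  dom (update s v a) = v |: dom s.
Proof. by apply/setP => u; rewrite !inE ffunE; case: eqP. Qed.

Lemma dom_update_full (A : Type) (s : assignment A) v a :
  dom s = setT -> dom (update s v a) = setT.
Proof. by rewrite dom_update => ->; rewrite setUT. Qed.

Lemma restrict_update (A : Type) (D : {set var}) (s : assignment A) v a :
  restrict (v |: D) (update s v a) = update (restrict D s) v a.
Proof. by apply/ffunP => u; rewrite !ffunE !inE; case: eqP. Qed.

Lemma dom_fill (A : Type) (a : A) (s : assignment A) : dom (fill a s) = setT.
Proof. by apply/setP => v; rewrite !inE ffunE. Qed.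

Lemma fill_eq (A : Type) (a : A) (D : {set var}) (s : assignment A) :
  dom s = D -> {in D, fill a s =1 s}.
Proof. by move=> <- v; rewrite inE ffunE; case: (s v). Qed.

Lemma update_id (A : Type) (s : assignment A) v a :
  s v = Some a -> update s v a = s.
Proof. by move=> sv; apply/ffunP => u; rewrite ffunE; case: eqP => [->|]. Qed.

Lemma update_agree (A : Type) (D : {set var}) (s s' : assignment A) v a :
  {in D, s =1 s'} -> {in v |: D, update s v a =1 update s' v a}.
Proof. by move=> eqs u; rewrite !inE !ffunE; case: eqP => //= _ /eqs. Qed.

(** The meaning of [FAtLeast 2], the only counting quantifier in the translation. *)
Lemma exists_two (A : Type) (P : A -> Prop) :
  (exists2 f : 'I_2 -> A, injective f & forall j, P (f j)) <->
  exists a b, [/\ a <> b, P a & P b].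
Proof.
split=> [[f f_inj Pf]|[a [b [ab Pa Pb]]]].
  by exists (f ord0), (f ord_max); split=> // /f_inj.
exists (fun j : 'I_2 => if j == ord0 then a else b) => [i j|j];
  last by case: eqP.
by case: (unliftP ord0 i) => [i' ->|->]; case: (unliftP ord0 j) => [j' ->|->];
  rewrite ?eqxx // ?[i']ord1 ?[j']ord1 //= => /esym.
Qed.

Definition other (v : var) : var := if v is vx then vy else vx.

Lemma update_both (A : Type) (s s' : assignment A) v a b :
  s' v = Some a -> s' (other v) = Some b ->
  update (update s v a) (other v) b = s'.
Proof.
by case: v => /= sa sb; apply/ffunP => -[]; rewrite !ffunE /=.
Qed.

Lemma atom_sat_agree (sigma : vocab) (A : structure sigma) (a : atom sigma)
    (s s' : assignment A) :
  {in atom_Fr a, s =1 s'} -> atom_sat s a -> atom_sat s' a.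
Proof.
case: a => [t1 t2|P ts] /= eqs; first by rewrite -!eqs ?inE ?eqxx ?orbT.
case=> b sb Pb; exists b => //; rewrite -sb; apply/eq_in_map => t tts.
by rewrite eqs // inE.
Qed.

Lemma has_dom_duplicate (A : Type) (X : team A) (D : {set var}) v :
  has_dom X D -> has_dom (team_duplicate X v) (v |: D).
Proof. by move=> XD _ [s Xs [a ->]]; rewrite dom_update XD. Qed.

Lemma has_dom_supplement (A : Type) (X : team A) (D : {set var}) v F :
  has_dom X D -> has_dom (team_supplement X v F) (v |: D).
Proof. by move=> XD _ [s Xs ->]; rewrite dom_update XD. Qed.

(** Members of [X] have domain exactly [D], so their values along [enum D] determine them. This
    turns a relational atom on [enum D] into team membership. *)
Lemma rel_of_team_sat (A : Type) (D : {set var}) (X : team A)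
    (s : assignment A) :
    inhabited A -> has_dom X D -> dom s = setT ->
  (exists2 b : #|D|.-tuple A,
     [seq s v | v <- enum D] = [seq Some c | c <- b] & rel_of_team X b) <->
  X (restrict D s).
Proof.
move=> [a] XD sT; split=> [[b sb [s' Xs' s'b]]|Xs].
  suff <- : s' = restrict D s by [].
  apply: eq_assignment => [|v]; first by rewrite dom_restrict // XD.
  rewrite (XD _ Xs') => vD; rewrite restrict_eq //.
  by move: s'b; rewrite -sb => /eq_in_map -> //; rewrite mem_enum.
pose b := [tuple of [seq odflt a (s v) | v <- enum_tuple D]].
have sb : [seq s v | v <- enum D] = [seq Some c | c <- b].
  rewrite /= -map_comp; apply: eq_map => v /=.
  by move/setP/(_ v): sT; rewrite !inE; case: (s v).
exists b => //; exists (restrict D s) => //; rewrite -sb.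
by apply/eq_in_map => v; rewrite mem_enum => /restrict_eq.
Qed.

(** * The translation *)

(* The quantified relation symbols of the translation.  The conjuncts of a
   conjunction share the team of the conjunction, so they need no new one. *)
Fixpoint occ (tau : vocab) (phi : d2 tau) : finType :=
  match phi with
  | DAnd phi psi => (occ phi + occ psi)%type
  | DOr phi psi => (option (occ phi) + option (occ psi))%type
  | DForall _ phi | DExists _ phi => option (occ phi)
  | _ => void
  end.

(** The size of this domain becomes the arity of the symbol. *)
Fixpoint occ_dom (tau : vocab) (phi : d2 tau) (D : {set var}) :
    occ phi -> {set var} :=
  match phi return occ phi -> {set var} with
  | DAnd phi psi => fun o =>
      match o with inl o => occ_dom D o | inr o => occ_dom D o end
  | DOr phi psi => fun o =>
      match o with
      | inl None | inr None => D
      | inl (Some o) => occ_dom D o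
      | inr (Some o) => occ_dom D o
      end
  | DForall v phi | DExists v phi => fun o =>
      if o is Some o then occ_dom (v |: D) o else v |: D
  | _ => fun _ => D
  end.

Definition lift_atom (tau : vocab) (n : nat) (I : Type) (r : I -> nat)
    (a : atom tau) : atom (extend (extend1 tau n) r) :=
  match a with
  | AEq t1 t2 => AEq t1 t2
  | ARel P ts => @ARel (extend (extend1 tau n) r) (inl (inl P)) ts
  end.

Definition FImp (sigma : vocab) (phi psi : foc2 sigma) : foc2 sigma :=
  FOr (FNot phi) psi.

(* The atom X, with free variables the domain of the current team, says that the
   current assignment is in that team.  The clauses are to hold at all total
   assignments. *)
Fixpoint team_clauses (tau : vocab) (n : nat) (I : Type) (r : I -> nat)
    (phi : d2 tau) (X : atom (extend (extend1 tau n) r)) :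
    (occ phi -> atom (extend (extend1 tau n) r)) ->
    foc2 (extend (extend1 tau n) r) :=
  match phi return (occ phi -> _) -> _ with
  | DLit a => fun _ => FImp (FAtom X) (FAtom (lift_atom n r a))
  | DNegLit a => fun _ => FImp (FAtom X) (FNot (FAtom (lift_atom n r a)))
  | DDep2 t1 t2 => fun _ =>
      if t1 == t2 then FAtom (AEq t1 t1) else FNot (FAtLeast 2 t2 (FAtom X))
  | DDep1 t => fun _ => FNot (FAtLeast 2 t (FExists (other t) (FAtom X)))
  | DNegDep2 _ _ | DNegDep1 _ => fun _ => FNot (FAtom X)
  | DAnd phi psi => fun e =>
      FAnd (team_clauses X (e \o inl)) (team_clauses X (e \o inr))
  | DOr phi psi => fun e =>
      FAnd (FImp (FAtom X) (FOr (FAtom (e (inl None))) (FAtom (e (inr None)))))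
        (FAnd (team_clauses (e (inl None)) (e \o inl \o Some))
              (team_clauses (e (inr None)) (e \o inr \o Some)))
  | DForall v phi => fun e =>
      FAnd (FImp (FAtom X) (FForall v (FAtom (e None))))
           (team_clauses (e None) (e \o Some))
  | DExists v phi => fun e =>
      FAnd (FImp (FAtom X) (FExists v (FAtom (e None))))
           (team_clauses (e None) (e \o Some))
  end.

(** * From clauses to team satisfaction *)

Lemma lift_atom_sat (tau : vocab) (n : nat) (I : Type) (r : I -> nat)
    (A : structure tau) (R : n.-tuple A -> Prop)
    (S : forall i, (r i).-tuple A -> Prop) (s : assignment A) (a : atom tau) :
  atom_sat (A := expand (A := expand1 R) S) s (lift_atom n r a) <->
  atom_sat s a.
Proof. by case: a. Qed.

(** Only an inclusion of [X] in the relation named by [theta] is assumed, and the induction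
    preserves it: the clause of a disjunction or quantifier yields teams inside the relations named
    by the new symbols. *)
Lemma team_clauses_sound (tau : vocab) (n : nat) (I : Type) (r : I -> nat)
    (A : structure tau) (R : n.-tuple A -> Prop)
    (S : forall i, (r i).-tuple A -> Prop) (phi : d2 tau)
    (B := expand (A := expand1 R) S) :
  forall (D : {set var}) (X : team A) (theta : atom (extend (extend1 tau n) r))
    (e : occ phi -> atom (extend (extend1 tau n) r)),
    has_dom X D -> d2_Fr phi \subset D ->
    atom_Fr theta = D -> (forall o, atom_Fr (e o) = occ_dom D o) ->
    (forall s : assignment A, X s -> atom_sat (A := B) s theta) ->
    (forall s : assignment A, dom s = setT ->
       foc2_sat (A := B) s (team_clauses theta e)) ->
  d2_sat X phi.
Proof.
have [a0] := carrier_inh A.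
have fill_sat D (X : team A) (theta : atom (extend (extend1 tau n) r)) s :
    has_dom X D -> atom_Fr theta = D -> X s ->
    atom_sat (A := B) s theta -> atom_sat (A := B) (fill a0 s) theta.
  move=> XD Fr Xs; apply: atom_sat_agree => v.
  by rewrite Fr => vD; rewrite (fill_eq a0 (XD _ Xs)).
have lit_sat D (X : team A) (a : atom tau) s :
    has_dom X D -> atom_Fr a \subset D -> X s ->
    atom_sat (A := B) (fill a0 s) (lift_atom n r a) <-> atom_sat s a.
  move=> XD aD Xs; rewrite lift_atom_sat; split; apply: atom_sat_agree => v;
    by move/(subsetP aD) => vD; rewrite (fill_eq a0 (XD _ Xs)).
elim: phi => [a|a|t1 t2|t1 t2|t|t|phi IHphi psi IHpsi|phi IHphi psi IHpsi
    |v phi IHphi|v phi IHphi] D X theta e XD sub Fr eFr Xsat clauses.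
- move=> s Xs; have H := or_to_imply _ _ (clauses _ (dom_fill a0 s)).
  apply/(lit_sat _ _ _ _ XD sub Xs)/H.
  exact: fill_sat _ _ _ _ XD Fr Xs (Xsat _ Xs).
- move=> s Xs; have H := or_to_imply _ _ (clauses _ (dom_fill a0 s)).
  move=> /(lit_sat _ _ _ _ XD sub Xs); apply: H.
  exact: fill_sat _ _ _ _ XD Fr Xs (Xsat _ Xs).
- move=> s s' Xs Xs' ss'; move: clauses => /=; case: eqP => [<- _|].
    by apply: ss'; rewrite inE.
  move=> t12 H.
  (* Two distinct variables are all the variables, so members of [X] are total and the clause can be
     read at [s] itself. *)
  have DT : D = setT.
    apply/eqP; rewrite eqEsubset subsetT /=; apply: subset_trans sub.
    apply/subsetP => u _; rewrite !inE.
    by move: t12; case: (u); case: (t1); case: (t2).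
  have [c sc] : exists c, s t2 = Some c by apply: domP; rewrite (XD _ Xs) DT.
  have [c' sc'] : exists c', s' t2 = Some c'.
    by apply: domP; rewrite (XD _ Xs') DT.
  rewrite sc sc'; apply: NNPP => cc'; apply: (H s); first by rewrite (XD _ Xs).
  apply: (proj2 (exists_two (fun a =>
    atom_sat (A := B) (update s t2 a) theta))).
  exists c, c'; split.
  + by move=> ecc'; case: cc'; rewrite ecc'.
  + by rewrite update_id //; exact: Xsat.
  + suff -> : update s t2 c' = s' by exact: Xsat.
    (* Away from [t2] there is only [t1], where [s] and [s'] agree. *)
    apply/ffunP => u; rewrite ffunE; case: eqP => [-> //|ut2].
    have -> : u = t1 by move: ut2 t12; case: (u); case: (t1); case: (t2).
    by apply: ss'; rewrite inE.
- move=> s Xs; apply: (clauses (fill a0 s) (dom_fill a0 s)).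
  exact: fill_sat _ _ _ _ XD Fr Xs (Xsat _ Xs).
- move=> s s' Xs Xs' _.
  have tD : t \in D by apply: (subsetP sub); rewrite inE.
  have [c sc] : exists c, s t = Some c by apply: domP; rewrite (XD _ Xs).
  have [c' sc'] : exists c', s' t = Some c' by apply: domP; rewrite (XD _ Xs').
  rewrite sc sc'; apply: NNPP => cc'.
  apply: (clauses _ (dom_fill a0 s)).
  apply: (proj2 (exists_two (fun a => exists b : A, atom_sat (A := B)
    (update (update (fill a0 s) t a) (other t) b) theta))).
  exists c, c'; split.
  + by move=> ecc'; case: cc'; rewrite ecc'.
  (* With this value the double update is [fill a0 s], whether or not [other t] lies in [D]. *)
  + exists (odflt a0 (s (other t))).
    rewrite (update_both _ (s' := fill a0 s)) ?ffunE ?sc //.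
    exact: fill_sat _ _ _ _ XD Fr Xs (Xsat _ Xs).
  + exists (odflt a0 (s' (other t))).
    rewrite (update_both _ (s' := fill a0 s')) ?ffunE ?sc' //.
    exact: fill_sat _ _ _ _ XD Fr Xs' (Xsat _ Xs').
- move=> s Xs; apply: (clauses (fill a0 s) (dom_fill a0 s)).
  exact: fill_sat _ _ _ _ XD Fr Xs (Xsat _ Xs).
- have /= := sub; rewrite subUset => /andP[sub1 sub2].
  split.
    apply: (IHphi _ _ _ _ XD sub1 Fr (fun o => eFr (inl o)) Xsat).
    by move=> s /clauses[].
  apply: (IHpsi _ _ _ _ XD sub2 Fr (fun o => eFr (inr o)) Xsat).
  by move=> s /clauses[].
- have /= := sub; rewrite subUset => /andP[sub1 sub2].
  (* The relations of the two symbols may exceed [X]; their traces on [X] cover it and have domain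
     [D]. *)
  exists (fun s => X s /\ atom_sat (A := B) s (e (inl None))).
  exists (fun s => X s /\ atom_sat (A := B) s (e (inr None))).
  split.
  + move=> s; split=> [Xs|]; last by tauto.
    have [/or_to_imply H _] := clauses _ (dom_fill a0 s).
    have [E|E] := H (fill_sat _ _ _ _ XD Fr Xs (Xsat _ Xs)); [left|right];
      split=> //; apply: atom_sat_agree E;
      by rewrite eFr; exact: fill_eq (XD _ Xs).
  + apply: (IHphi _ _ _ _ _ sub1 (eFr (inl None))
             (fun o => eFr (inl (Some o)))).
    * by move=> s [/XD].
    * by move=> s [].
    * by move=> s /clauses[_ []].
  + apply: (IHpsi _ _ _ _ _ sub2 (eFr (inr None))
             (fun o => eFr (inr (Some o)))).
    * by move=> s [/XD].
    * by move=> s [].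
    * by move=> s /clauses[_ []].
- apply: (IHphi _ _ _ _ (has_dom_duplicate XD) _ (eFr None)
           (fun o => eFr (Some o))).
  + by rewrite -subDset.
  + move=> _ [s Xs [a ->]].
    have [/or_to_imply H _] := clauses _ (dom_fill a0 s).
    have := H (fill_sat _ _ _ _ XD Fr Xs (Xsat _ Xs)) a.
    apply: atom_sat_agree; rewrite eFr; apply: update_agree.
    exact: fill_eq (XD _ Xs).
  + by move=> s /clauses[].
(* Choice of a witness for each member of [X]; elsewhere the value may be arbitrary. *)
- pose F (s : assignment A) := epsilon (inhabits a0)
    (fun a => atom_sat (A := B) (update s v a) (e None)).
  exists F.
  apply: (IHphi _ _ _ _ (has_dom_supplement XD) _ (eFr None)
           (fun o => eFr (Some o))).
  + by rewrite -subDset.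
  + move=> _ [s Xs ->]; apply: (epsilon_spec (inhabits a0)
      (fun a => atom_sat (A := B) (update s v a) (e None))).
    have [/or_to_imply H _] := clauses _ (dom_fill a0 s).
    have [a Ha] := H (fill_sat _ _ _ _ XD Fr Xs (Xsat _ Xs)); exists a.
    move: Ha; apply: atom_sat_agree; rewrite eFr; apply: update_agree.
    exact: fill_eq (XD _ Xs).
  + by move=> s /clauses[].
Qed.

(** * From team satisfaction to clauses *)

(** An equivalence, since a symbol occurs positively in the clause that introduces it but negatively
    in the clauses of its own subformula. *)
Definition represents (sigma : vocab) (B : structure sigma) (D : {set var})
    (X : team B) (theta : atom sigma) : Prop :=
  forall s : assignment B, dom s = setT ->
    atom_sat s theta <-> X (restrict D s).

(** The teams [T] come before [I], [r], [S] and [e]: the clauses of a subformula live in the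
    vocabulary of the whole formula, whose interpretation is fixed only once all teams are known. *)
Lemma team_clauses_complete (tau : vocab) (n : nat) (A : structure tau)
    (R : n.-tuple A -> Prop) (phi : d2 tau) :
  forall (D : {set var}) (X : team A),
    has_dom X D -> d2_Fr phi \subset D -> d2_sat X phi ->
  exists2 T : occ phi -> team A, forall o, has_dom (T o) (occ_dom D o) &
    forall (I : Type) (r : I -> nat) (S : forall i, (r i).-tuple A -> Prop)
      (theta : atom (extend (extend1 tau n) r))
      (e : occ phi -> atom (extend (extend1 tau n) r)),
    represents (B := expand (A := expand1 R) S) D X theta ->
    (forall o, represents (B := expand (A := expand1 R) S)
                 (occ_dom D o) (T o) (e o)) ->
    forall s : assignment A, dom s = setT ->
      foc2_sat (A := expand (A := expand1 R) S) s (team_clauses theta e).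
Proof.
elim: phi => [a|a|t1 t2|t1 t2|t|t|phi IHphi psi IHpsi|phi IHphi psi IHpsi
    |v phi IHphi|v phi IHphi] D X XD sub sat.
(* Here [occ] is [void], so any [T] will do. *)
- exists (fun _ _ => False) => // I r S theta e rep _ s sT.
  apply: imply_to_or => /= /(rep _ sT)/sat Xs; apply/lift_atom_sat.
  by apply: atom_sat_agree Xs => v /(subsetP sub)/restrict_eq.
- exists (fun _ _ => False) => // I r S theta e rep _ s sT.
  apply: imply_to_or => /= /(rep _ sT)/sat Xs /lift_atom_sat sa; apply: Xs.
  by apply: atom_sat_agree sa => v /(subsetP sub)/restrict_eq.
- exists (fun _ _ => False) => // I r S theta e rep _ s sT /=.
  case: eqP => // /eqP t12.
  move/(proj1 (exists_two (fun a =>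
    atom_sat (A := expand (A := expand1 R) S) (update s t2 a) theta))).
  move=> [a [b [ab]]].
  have [t1D t2D] : t1 \in D /\ t2 \in D.
    by split; apply: (subsetP sub); rewrite !inE eqxx ?orbT.
  move=> /(rep _ (dom_update_full _ _ sT)) Xa.
  move=> /(rep _ (dom_update_full _ _ sT)) Xb.
  (* Both members arise from [s] by changing [t2] alone, so they agree at [t1]. *)
  have := sat _ _ Xa Xb; rewrite !ffunE t2D eqxx => H.
  suff [] : Some a = Some b by [].
  by apply: H => u; rewrite inE => /eqP->; rewrite !ffunE t1D (negPf t12).
- exists (fun _ _ => False) => // I r S theta e rep _ s sT.
  by move/(rep _ sT)/sat.
- exists (fun _ _ => False) => // I r S theta e rep _ s sT /=.
  move/(proj1 (exists_two (fun a => exists b : A,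
    atom_sat (A := expand (A := expand1 R) S)
      (update (update s t a) (other t) b) theta))).
  move=> [a [b [ab [c ca] [d db]]]].
  have tD : t \in D by apply: (subsetP sub); rewrite inE.
  have dT w w' a' b' : dom (update (update s w a') w' b') = setT.
    by do 2!apply: dom_update_full.
  have := sat _ _ (proj1 (rep _ (dT _ _ _ _)) ca)
                  (proj1 (rep _ (dT _ _ _ _)) db).
  have tt' : (t == other t) = false by case: (t).
  rewrite !ffunE tD tt' eqxx => H.
  by suff [] : Some a = Some b by []; apply: H.
- exists (fun _ _ => False) => // I r S theta e rep _ s sT.
  by move/(rep _ sT)/sat.
- have /= := sub; rewrite subUset => /andP[sub1 sub2]; case: sat => sat1 sat2.
  have [T TD Tsat] := IHphi _ _ XD sub1 sat1.
  have [U UD Usat] := IHpsi _ _ XD sub2 sat2.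
  exists (fun o => match o with inl o => T o | inr o => U o end).
    by case=> o; [exact: TD | exact: UD].
  move=> I r S theta e rep reps s sT; split.
    by apply: Tsat => // o; exact: reps (inl o).
  by apply: Usat => // o; exact: reps (inr o).
- have /= := sub; rewrite subUset => /andP[sub1 sub2].
  case: sat => Y [Z [XYZ sat1 sat2]].
  have YD : has_dom Y D by move=> s Ys; apply: XD; apply/XYZ; left.
  have ZD : has_dom Z D by move=> s Zs; apply: XD; apply/XYZ; right.
  have [T TD Tsat] := IHphi _ _ YD sub1 sat1.
  have [U UD Usat] := IHpsi _ _ ZD sub2 sat2.
  exists (fun o => match o with
                   | inl o => oapp T Y o | inr o => oapp U Z o end).
    by case=> -[o|]; [exact: TD | exact: YD | exact: UD | exact: ZD].
  move=> I r S theta e rep reps s sT; split; last split.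
  + apply: imply_to_or => /(rep _ sT)/XYZ[Ys|Zs]; [left|right].
      exact/(reps (inl None) _ sT).
    exact/(reps (inr None) _ sT).
  + apply: Tsat => // [|o]; first exact: reps (inl None).
    exact: reps (inl (Some o)).
  + apply: Usat => // [|o]; first exact: reps (inr None).
    exact: reps (inr (Some o)).
- have sub1 : d2_Fr phi \subset v |: D by rewrite -subDset.
  have [T TD Tsat] := IHphi _ _ (has_dom_duplicate XD) sub1 sat.
  exists (oapp T (team_duplicate X v)).
    by case=> [o|] /=; [exact: TD | exact: has_dom_duplicate].
  move=> I r S theta e rep reps s sT; split.
    apply: imply_to_or => /(rep _ sT) Xs a.
    apply/(reps None); first exact: dom_update_full.
    by rewrite /= restrict_update; exists (restrict D s) => //; exists a.
  apply: Tsat => // [|o]; first exact: reps None.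
  exact: reps (Some o).
- case: sat => F sat.
  have sub1 : d2_Fr phi \subset v |: D by rewrite -subDset.
  have [T TD Tsat] := IHphi _ _ (has_dom_supplement XD) sub1 sat.
  exists (oapp T (team_supplement X v F)).
    by case=> [o|] /=; [exact: TD | exact: has_dom_supplement].
  move=> I r S theta e rep reps s sT; split.
    apply: imply_to_or => /(rep _ sT) Xs; exists (F (restrict D s)).
    apply/(reps None); first exact: dom_update_full.
    by rewrite /= restrict_update; exists (restrict D s).
  apply: Tsat => // [|o]; first exact: reps None.
  exact: reps (Some o).
Qed.

(** * Assembling the sentence *)

Theorem theorem5p1 (tau : vocab) (tau_le2 : forall P : sym tau, ar P <= 2)
    (phi : d2 tau) :
  exists phi_star : eso_foc2 (extend1 tau #|d2_Fr phi|),
    [/\ eso_sentence phi_star,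
        forall i, @eso_ar _ phi_star i <= 2
      & forall (A : structure tau) (X : team A), has_dom X (d2_Fr phi) ->
          (d2_sat X phi <->
           eso_holds (expand1 (@rel_of_team A (d2_Fr phi) X)) phi_star)].
Proof.
set D := d2_Fr phi.
(* The second-order prefix is indexed by ordinals, so the elements of [occ phi] are numbered by
   [enum_rank]. *)
pose Dom (i : 'I_#|occ phi|) := occ_dom D (enum_val i).
pose r i := #|Dom i|.
pose theta := @ARel (extend (extend1 tau #|D|) r) (inl (inr tt)) (enum_tuple D).
(* Writing [Dom (enum_rank o)] instead of [occ_dom D o] makes the length of the argument tuple
   convertible to the arity of the symbol. *)
pose e (o : occ phi) := @ARel (extend (extend1 tau #|D|) r) (inr (enum_rank o))
  (enum_tuple (Dom (enum_rank o))).
have thetaFr : atom_Fr theta = D by apply/setP => v; rewrite inE mem_enum.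
have eFr o : atom_Fr (e o) = occ_dom D o.
  by apply/setP => v; rewrite inE mem_enum /Dom enum_rankK.
exists (EsoFoc2 (FForall vx (FForall vy (team_clauses theta e)))).
split.
- by apply/setP => -[]; rewrite !inE /= ?andbF.
(* Each arity counts a set of variables, and there are two variables. *)
- move=> i; apply: leq_trans (max_card _) _.
  by rewrite cardE enumT unlock.
move=> A X XD; split=> [sat|[S sat]].
  have [T TD Tsat] :=
    team_clauses_complete (rel_of_team (D := D) X) XD (subxx _) sat.
  exists (fun i => rel_of_team (D := Dom i) (T (enum_val i))) => a b.
  apply: Tsat.
  - move=> s sT; apply: rel_of_team_sat => //; exact: carrier_inh.
  - move=> o s sT.
    have := rel_of_team_sat (carrier_inh A) (TD (enum_val (enum_rank o))) sT.
    (* The pattern confines the replacement of [enum_val (enum_rank o)] by [o] to the right side,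
       away from the tuple types on the left. *)
    rewrite [X in _ <-> X](_ : _ = T o (restrict (occ_dom D o) s)) //.
    by rewrite enum_rankK.
  - by apply/setP => -[]; rewrite !inE !ffunE.
apply: (team_clauses_sound (R := rel_of_team (D := D) X) (S := S)
          XD (subxx _) thetaFr eFr) => [s Xs|s sT].
  have [b sb] : exists b : #|D|.-tuple A,
      [seq s v | v <- enum D] = [seq Some c | c <- b].
    have [a0] := carrier_inh A.
    (* The default is never taken, as [s] is defined on [D]. *)
    exists [tuple of [seq odflt a0 (s v) | v <- enum_tuple D]].
    rewrite /= -map_comp; apply/eq_in_map => v.
    by rewrite mem_enum => vD /=; rewrite -(fill_eq a0 (XD _ Xs)) // ffunE.
  by exists b => //; exists s.
(* The prefix over both variables reaches every total assignment from the empty one. *)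
have [a sa] : exists a, s vx = Some a by apply: domP; rewrite sT.
have [b sb] : exists b, s vy = Some b by apply: domP; rewrite sT.
by rewrite -(update_both (empty_assignment A) (v := vx) sa sb); exact: sat.
Qed.
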